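(* Consider finite collocation sets $\Omega^h\subset\Omega$ and $\Gamma^h\subset\Gamma$ with $\Omega^h\cap\Gamma^h=\emptyset$ and set $N=|\Omega^h\cup\Gamma^h|$. Let $\mathcal H$ be the set of depth-$L$ neural networks $\mathbb{R}^d\to\mathbb{R}^c$ (arbitrary hidden-layer widths, no bound on the parameters) with either (i) ReLU activation functions and $L\ge2$, or (ii) non-polynomial activation functions $\sigma\in C(\mathbb{R},\mathbb{R})$ and $L=2$, or (iii) activation $\sigma\in C^{\ell-d}(\mathbb{R},\mathbb{R})$, $\ell:=Nd$, satisfying $\sigma^{(k)}(a)\ne0$ for some $a\in\mathbb{R}$ and all $0\le k\le\ell-d$, and $L=2$. Then: (a) If $u_h\in\mathbb{R}^{N\times c}$ is a solution of $\min_{u\in\mathbb{R}^{N\times c}}\mathcal J_{\mathrm{FD}}(u)$, then there exists $u_\theta\in\mathcal H$ minimizing $\mathcal J_\theta$ over $\mathcal H$ with $\mathcal J_{\mathrm{FD}}(u_h)=\mathcal J_\theta(u_\theta)$ and $u_h(z)=u_\theta(z)$ for all $z\in\Omega^h\cup\Gamma^h$. (b) If $u_\theta\in\mathcal H$ is a solution of $\min_{u_\theta\in\mathcal H}\mathcal J_\theta(u_\theta)$, then there exists $u_h\in\mathbb{R}^{N\times c}$ minimizing $\mathcal J_{\mathrm{FD}}$ over $\mathbb{R}^{N\times c}$ with $\mathcal J_{\mathrm{FD}}(u_h)=\mathcal J_\theta(u_\theta)$ and $u_h(z)=u_\theta(z)$ for all $z\in\Omega^h\cup\Gamma^h$.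
   Context: $\Omega\subset\mathbb{R}^d$ is a bounded domain with Lipschitz boundary, $\Gamma\subseteq\partial\Omega$. An element $u\in\mathbb{R}^{N\times c}$ is a grid function on $\Omega^h\cup\Gamma^h$; $u(z)\in\mathbb{R}^c$ is its value at $z$. $\mathcal F_h$ and $\mathcal B_h$ are finite-difference discretizations of differential operators: $\mathcal F_h(u(z))\in\mathbb{R}^{c_{\mathcal F}}$ for $z\in\Omega^h$ and $\mathcal B_h(u(z))\in\mathbb{R}^{c_{\mathcal B}}$ for $z\in\Gamma^h$ denote the values at $z$ of the discrete operators applied to $u$; they depend only on the values of $u$ on $\Omega^h\cup\Gamma^h$ (possibly at neighbouring grid points). $\mathcal D^h\subseteq\Omega^h\cup\Gamma^h$ is the set of data locations with data $u^*(z)\in\mathbb{R}^c$; $\alpha_{\mathcal F},\alpha_{\mathcal B},\alpha_{\mathcal D}\ge0$; $\omega_{\mathcal F}^z,\omega_{\mathcal B}^z,\omega_{\mathcal D}^z\in\mathbb{R}$ are quadrature weights; $\nu\in[1,\infty)$ and $|\cdot|_\nu$ is the $\ell^\nu$-norm. Define for $u\in\mathbb{R}^{N\times c}$ $$\mathcal J_{\mathrm{FD}}(u)=\alpha_{\mathcal F}\sum_{z\in\Omega^h}\omega_{\mathcal F}^z|\mathcal F_h(u(z))|_\nu^\nu+\alpha_{\mathcal B}\sum_{z\in\Gamma^h}\omega_{\mathcal B}^z|\mathcal B_h(u(z))|_\nu^\nu+\alpha_{\mathcal D}\sum_{z\in\mathcal D^h}\omega_{\mathcal D}^z|u(z)-u^*(z)|_\nu^\nu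 ,$$ and for a neural network $u_\theta$ let $\mathcal J_\theta(u_\theta)$ (the FD-PINN loss) be the same expression evaluated at the grid values of $u_\theta$ on $\Omega^h\cup\Gamma^h$. Minimizers are global minimizers. A depth-$L$ neural network with activation $\sigma:\mathbb{R}\to\mathbb{R}$ is a map $f:\mathbb{R}^d\to\mathbb{R}^c$ of the form $\varphi_0(x)=x$, $\varphi_i(x)=\sigma(W_i\varphi_{i-1}(x)+b_i)$ for $i=1,\dots,L-1$ ($\sigma$ componentwise), $f(x)=W_L\varphi_{L-1}(x)+b_L$, with $W_i\in\mathbb{R}^{d_i\times d_{i-1}}$, $b_i\in\mathbb{R}^{d_i}$, $d_0=d$, $d_L=c$, hidden widths $d_i\in\mathbb{N}$. ReLU is $\sigma(x)=\max\{0,x\}$. Elements of $\mathcal H$ are regarded as functions on $\overline\Omega$. *)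

(* Defs.v *)
From mathcomp Require Import all_boot all_order all_algebra finmap.
From mathcomp Require Import all_classical all_reals all_analysis.

Set Implicit Arguments.
Unset Strict Implicit.
Unset Printing Implicit Defensive.

Import Order.TTheory GRing.Theory Num.Theory.
Import numFieldNormedType.Exports.

Local Open Scope classical_set_scope.
Local Open Scope ring_scope.

Definition boundary (T : topologicalType) (A : set T) : set T :=
  closure A `\` interior A.

(* Near every boundary point [A] is, up to the orthogonal change of coordinates
   [Q], the strict epigraph of a Lipschitz function of the coordinates other
   than the [i]-th one.  Balls and Lipschitz constants are taken in the library
   norm on matrices, i.e. the max norm; any other norm on R^d gives the same
   notion. *)
Definition lipschitz_boundary (R : realType) (d : nat) (A : set 'cV[R]_d) :
    Prop :=
  forall x, boundary A x ->
  exists (r : R) (Q : 'M[R]_d) (i : 'I_d) (g : 'cV[R]_(d.-1) -> R),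
    [/\ 0 < r, Q *m Q^T = 1%:M, lipschitz g &
      A `&` ball x r
      = [set y | g (row' i (Q *m y)) < (Q *m y) i 0] `&` ball x r].

Definition bounded_lipschitz_domain (R : realType) (d : nat)
    (A : set 'cV[R]_d) : Prop :=
  [/\ A !=set0, open A, connected A, bounded_set A & lipschitz_boundary A].

Definition relu (R : realType) : R -> R := fun x => Num.max 0 x.

(* [hidden_layers sigma d i n phi]: [phi] has the form [phi_i], with values in
   R^n, where phi_0(x) = x and
   phi_(i+1)(x) = sigma (W *m phi_i(x) + b), all layer widths being positive. *)
Inductive hidden_layers (R : realType) (sigma : R -> R) (d : nat) :
    forall i n : nat, ('cV[R]_d -> 'cV[R]_n) -> Prop :=
| HiddenInput : @hidden_layers R sigma d 0 d (fun x => x)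
| HiddenLayer (i m n : nat) (phi : 'cV[R]_d -> 'cV[R]_m)
    (W : 'M[R]_(n, m)) (b : 'cV[R]_n) :
    (0 < n)%N -> @hidden_layers R sigma d i m phi ->
    @hidden_layers R sigma d i.+1 n
      (fun x => map_mx sigma (W *m phi x + b)).

(* A network of depth [L] has [L - 1] hidden layers and an affine output. *)
Definition neural_networks (R : realType) (sigma : R -> R) (L d c : nat) :
    set ('cV[R]_d -> 'cV[R]_c) :=
  [set f | exists (i m : nat) (phi : 'cV[R]_d -> 'cV[R]_m)
             (W : 'M[R]_(c, m)) (b : 'cV[R]_c),
     [/\ L = i.+1, hidden_layers sigma i phi &
         f = (fun x => W *m phi x + b)]].
Arguments neural_networks {R} sigma L d c _.

Definition polynomial_function (R : realType) (f : R -> R) : Prop :=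
  exists p : {poly R}, forall x, f x = p.[x].

Definition continuously_differentiable (R : realType) (m : nat) (f : R -> R) :
    Prop :=
  (forall k, (k < m)%N -> forall x, derivable (derive1n k f) x 1) /\
  (forall k, (k <= m)%N -> continuous (derive1n k f)).

Definition lnorm (R : realType) (nu : R) (n : nat) (x : 'cV[R]_n) : R :=
  (\sum_(i < n) `|x i 0| `^ nu) `^ nu^-1.

(* R^(N x c), with rows indexed by the [N] points of Oh U Gh. *)
Definition grid_function (R : realType) (d c : nat) (Oh Gh : {fset 'cV[R]_d}) :
    Type :=
  {ffun (Oh `|` Gh)%fset -> 'cV[R]_c}.

Definition grid_values (R : realType) (d c : nat) (Oh Gh : {fset 'cV[R]_d})
    (f : 'cV[R]_d -> 'cV[R]_c) : grid_function c Oh Gh :=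
  [ffun z => f (val z)].

(* [Fh u z] and [Bh u z] are the values at [z] of the discrete operators applied
   to the grid function [u]; they may use all values of [u]. *)
Definition J_FD (R : realType) (d c cF cB : nat) (Oh Gh Dh : {fset 'cV[R]_d})
    (Fh : grid_function c Oh Gh -> Oh -> 'cV[R]_cF)
    (Bh : grid_function c Oh Gh -> Gh -> 'cV[R]_cB)
    (subD : (Dh `<=` Oh `|` Gh)%fset) (ustar : Dh -> 'cV[R]_c)
    (alphaF alphaB alphaD : R)
    (omegaF : Oh -> R) (omegaB : Gh -> R) (omegaD : Dh -> R)
    (nu : R) (u : grid_function c Oh Gh) : R :=
  alphaF * (\sum_(z : Oh) omegaF z * lnorm nu (Fh u z) `^ nu)
  + alphaB * (\sum_(z : Gh) omegaB z * lnorm nu (Bh u z) `^ nu)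
  + alphaD * (\sum_(z : Dh)
                omegaD z * lnorm nu (u (fincl subD z) - ustar z) `^ nu).

Definition is_minimizer (R : realType) (T : Type) (S : set T) (J : T -> R)
    (x : T) : Prop :=
  S x /\ forall y, S y -> J x <= J y.

(* Main.v *)
Require Import Defs.
From mathcomp Require Import all_boot all_order all_algebra finmap.
From mathcomp Require Import all_classical all_reals all_analysis.
From mathcomp Require Import ring.

Set Implicit Arguments.
Unset Strict Implicit.
Unset Printing Implicit Defensive.

Import Order.TTheory GRing.Theory Num.Theory.
Import numFieldNormedType.Exports.

Local Open Scope classical_set_scope.
Local Open Scope ring_scope.

(** Both parts hold because networks can interpolate: for every grid function
    [u] some network in the class takes the value [u z] at each grid point [z]
    ([network_interpolation]).  The loss of a network sees only its grid values,
    so the two minimization problems have the same set of attained values, and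
    minimizers correspond through restriction to the grid.

    For interpolation with one hidden layer, a direction [w] along which the
    points project to distinct reals [t i] ([separating_direction]) reduces the
    question to one dimension.  It then suffices that the vectors
    [(sigma (a * t i + b))_i], for varying [a] and [b], span the whole space,
    i.e. that no nonzero [c] satisfies [\sum_i c i * sigma (a * t i + b) = 0] for
    all [a], [b] ([ridge_independent]); finitely many hidden units then form a
    family dual to the points ([dual_family]).

    - If [sigma] is continuous, moving [(a, b)] so that one of the arguments
      [a * t k + b] stays fixed and subtracting removes the [k]-th term, at the
      price of a finite difference in every other term.  Removing all terms but
      one shows that an iterated difference of [sigma] vanishes for every step,
      and continuity makes [sigma] a polynomial: the one-dimensional theorem of
      Frechet ([continuous_fdiff_poly]).
    - If [sigma] is smooth with nonvanishing derivatives at [a], differentiating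
      the relation [k] times in the slope at slope zero gives
      [\sum_i c i * t i ^+ k = 0] for all [k] less than the number of points, a
      Vandermonde system ([ridge_independent_smooth]).
    - ReLU is continuous and not a polynomial.  Extra depth is harmless: a large
      bias keeps all arguments of a layer nonnegative at the grid points, where
      ReLU is the identity, so that the points stay distinct
      ([relu_injective_layers]). *)

(** * Linear algebra on a finite set of points *)

Lemma poly_eq0_nat (R : numDomainType) (p : {poly R}) :
  (forall k : nat, p.[k%:R] = 0) -> p = 0.
Proof.
move=> p0; apply/eqP/negPn/negP => pN0.
have /max_poly_roots - /(_ pN0) : all (root p) [seq k%:R | k <- iota 0 (size p)].
  by apply/allP => _ /mapP[k _ ->]; apply/rootP.
rewrite map_inj_uniq; last by move=> i j /eqP; rewrite eqr_nat => /eqP.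
by rewrite iota_uniq size_map size_iota ltnn => /(_ isT).
Qed.

(** If the vectors [g p] satisfy no common linear relation they span [R^I].  As
    long as a finite selection of them is not of full rank, some vector killed
    by the selection is not killed by every [g p], and adding such a [g p]
    increases the rank.  The family is never empty, which makes it usable as a
    hidden layer even when [I] is empty. *)
Lemma dual_family (R : fieldType) (P : Type) (I : finType) (g : P -> I -> R)
    (p0 : P) :
  (forall c : I -> R, (forall p, \sum_i c i * g p i = 0) -> forall i, c i = 0) ->
  exists (n : nat) (p : 'I_n.+1 -> P) (e : I -> 'I_n.+1 -> R),
    forall i i', \sum_j e i j * g (p j) i' = (i == i')%:R.
Proof.
move=> indep.
pose M n (p : 'I_n.+1 -> P) : 'M[R]_(n.+1, #|I|) :=
  \matrix_(j, i) g (p j) (enum_val i).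
have rankM k : (k <= #|I|)%N -> exists n (p : 'I_n.+1 -> P), (k <= \rank (M n p))%N.
  elim: k => [_|k IHk kI]; first by exists 0%N, (fun _ => p0).
  have [n [p kp]] := IHk (ltnW kI).
  have [full|] := boolP (row_full (M n p)).
    by exists n, p; rewrite (eqP full).
  rewrite -cokermx_eq0 => /matrix0Pn[i0 [j0 cN0]].
  (* The column [j0] of the cokernel is orthogonal to the vectors chosen so far. *)
  pose c i := cokermx (M n p) (enum_rank i) j0.
  have [q cq] : exists q, \sum_i c i * g q i <> 0.
    apply/existsNP => /indep /(_ (enum_val i0)) /eqP.
    by rewrite /c enum_valK (negPf cN0).
  pose p' j := if unlift ord0 j is Some j' then p j' else q.
  exists n.+1, p'; apply: (leq_ltn_trans kp).
  suff : (M n p < M n.+1 p')%MS by rewrite ltmxErank => /andP[].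
  apply/andP; split.
    apply/row_subP => j; rewrite [row j _](_ : _ = row (lift ord0 j) (M n.+1 p')).
      exact: row_sub.
    by apply/rowP => i; rewrite !mxE /p' liftK.
  apply/negP => /(submx_trans (row_sub ord0 _)).
  rewrite submxE => /eqP /matrixP /(_ 0 j0); rewrite !mxE => s0; apply: cq.
  rewrite -[RHS]s0 (reindex (@enum_val I predT)) /=; last exact/onW_bij/enum_val_bij.
  by apply: eq_bigr => i _; rewrite /c enum_valK !mxE /p' unlift_none mulrC.
have [n [p full]] := rankM _ (leqnn _).
have /row_fullP[B BM] : row_full (M n p) by rewrite /row_full eqn_leq rank_leq_col full.
exists n, p, (fun i j => B (enum_rank i) j) => i i'.
have /matrixP /(_ (enum_rank i) (enum_rank i')) := BM.
rewrite !mxE (inj_eq enum_rank_inj) => <-.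
by apply: eq_bigr => j _; rewrite mxE enum_rankK.
Qed.

(** The direction [(1, k, k^2, ...)] fails to separate [x i] from [x j] only if
    [k] is a root of the nonzero polynomial whose coefficients are the entries of
    [x i - x j]; some natural number avoids the roots of all these polynomials. *)
Lemma separating_direction (R : numFieldType) (m : nat) (I : finType)
    (x : I -> 'cV[R]_m) :
  injective x -> exists w : 'rV[R]_m, injective (fun i => (w *m x i) 0 0).
Proof.
move=> xI; pose p i j := rVpoly (x i - x j)^T.
pose P := \prod_(ij : I * I | ij.1 != ij.2) p ij.1 ij.2.
have pN0 i j : i != j -> p i j != 0.
  apply: contra => /eqP/(congr1 (@poly_rV _ m)); rewrite rVpolyK linear0 => /eqP.
  by rewrite trmx_eq0 subr_eq0 => /eqP /xI ->.
have [k Pk] : exists k : nat, P.[k%:R] <> 0.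
  apply/existsNP => /poly_eq0_nat /eqP; apply/negP.
  by apply/prodf_neq0 => -[i j] /= /pN0.
exists (\row_l k%:R ^+ l) => i j /= xij; apply/eqP/negPn/negP => ij.
apply: Pk; rewrite /P (bigD1 (i, j)) //= hornerM.
suff -> : (p i j).[k%:R] = 0 by rewrite mul0r.
move: xij => /eqP; rewrite -subr_eq0 => /eqP xij.
rewrite (horner_coef_wide _ (size_poly _ _)) -[RHS]xij !mxE -sumrB.
by apply: eq_bigr => l _; rewrite coef_rVpoly_ord !mxE mulrC mulrBr.
Qed.

(** * Finite differences and Frechet's theorem *)

Definition fdiff (R : realType) (h : R) (f : R -> R) : R -> R :=
  fun x => f (x + h) - f x.

(** Each step replaces [(a, b)] by [(a + r, b - r * t k)], which fixes
    [a * t k + b] and moves every other [a * t i + b] by [r * (t i - t k)].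
    Subtracting therefore drops the [k]-th term.  The choice of [r] makes the
    difference in the [j]-th term have step [h] at every stage.  The functions
    [F i] vary with [i] because the steps in the other terms differ. *)
Lemma fdiff_eliminate (R : realType) (I : eqType) (t : I -> R) (j : I)
    (s : seq I) (F : I -> R -> R) (h : R) :
  injective t -> j \notin s ->
  (forall a b, F j (a * t j + b) + \sum_(i <- s) F i (a * t i + b) = 0) ->
  forall x, iter (size s) (fdiff h) (F j) x = 0.
Proof.
move=> tI; elim: s F => [|k s IHs] F /= js F0 x.
  by have := F0 0 x; rewrite big_nil mul0r add0r addr0.
move: js; rewrite inE negb_or => /andP[jk js].
have tjk : t j - t k != 0 by rewrite subr_eq0 (inj_eq tI).
pose r := h / (t j - t k).
rewrite -iterS iterSr.
pose G i := fdiff (r * (t i - t k)) (F i).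
have -> : fdiff h (F j) = G j by rewrite /G /r divfK.
apply: IHs => // a b.
have GE i : G i (a * t i + b) =
    F i ((a + r) * t i + (b - r * t k)) - F i (a * t i + b).
  by rewrite /G /fdiff; congr (F i _ - _); ring.
under eq_bigr do rewrite GE.
rewrite GE sumrB addrACA -opprD; apply/eqP; rewrite subr_eq0; apply/eqP.
have := F0 a b; have := F0 (a + r) (b - r * t k); rewrite !big_cons.
have -> : (a + r) * t k + (b - r * t k) = a * t k + b by ring.
rewrite ![F j _ + (_ + _)]addrCA => E1 E2.
by apply: (addrI (F k (a * t k + b))); rewrite E1 E2.
Qed.

(** Newton's forward difference formula: passing from [k] to [k + 1] adds a first
    difference to [f], which Pascal's rule absorbs into the binomials. *)
Lemma newton_forward (R : realType) (h x : R) (n : nat) (f : R -> R) (k : nat) :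
  (forall y, iter n (fdiff h) f y = 0) ->
  f (x + k%:R * h) = \sum_(j < n) iter j (fdiff h) f x * 'C(k, j)%:R.
Proof.
elim: n f k => [|n IHn] f k f0; first by rewrite big_ord0; exact: f0.
elim: k => [|k IHk].
  rewrite mul0r addr0 big_ord_recl /= bin0 mulr1 big1 ?addr0 // => i _.
  by rewrite bin0n mulr0.
have -> : f (x + k.+1%:R * h) = f (x + k%:R * h) + fdiff h f (x + k%:R * h).
  by rewrite /fdiff [RHS]addrC subrK -addn1 natrD mulrDl mul1r addrA.
rewrite IHk IHn => [|y]; last by rewrite -iterSr; exact: f0.
rewrite !big_ord_recl /= !bin0 -addrA; congr (_ + _).
rewrite -big_split /=; apply: eq_bigr => i _.
by rewrite -iterSr /bump /= add1n binS natrD mulrDr.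
Qed.

Lemma bin_poly (R : numFieldType) (j : nat) :
  exists p : {poly R}, forall k : nat, p.[k%:R] = 'C(k, j)%:R.
Proof.
elim: j => [|j [p pE]]; first by exists 1 => k; rewrite hornerC bin0.
exists (j.+1%:R^-1 *: (('X - j%:R%:P) * p)) => k.
rewrite hornerZ hornerM hornerXsubC pE; apply: (mulfI (x := j.+1%:R)); first by rewrite pnatr_eq0.
rewrite mulVKf ?pnatr_eq0 // -natrM mul_bin_left natrM.
have [jk|kj] := leqP j k; first by rewrite natrB.
by rewrite bin_small // !mulr0.
Qed.

(** By Newton's formula the values on one grid are a polynomial in the index [k],
    hence in the grid point. *)
Lemma fdiff_grid_poly (R : realType) (n : nat) (f : R -> R) (x h : R) :
  h != 0 -> (forall y, iter n (fdiff h) f y = 0) ->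
  exists p : {poly R}, forall k : nat, f (x + k%:R * h) = p.[x + k%:R * h].
Proof.
move=> h0 f0; have [B BE] := choice (@bin_poly R).
pose q := \sum_(j < n) iter j (fdiff h) f x *: B j.
exists (q \Po (h^-1 *: ('X - x%:P))) => k.
rewrite horner_comp hornerZ hornerXsubC addrAC subrr add0r mulrCA mulVf //.
rewrite mulr1 horner_sum.
rewrite (newton_forward x k f0); apply: eq_bigr => j _.
by rewrite hornerZ BE.
Qed.

(** The polynomials obtained on different grids agree as soon as the grids share
    infinitely many points.  Every rational lies on a grid [- K + k / m] that
    contains all natural numbers, so a single polynomial fits all rationals, and
    density concludes. *)
Lemma continuous_fdiff_poly (R : realType) (n : nat) (f : R -> R) :
  continuous f -> (forall h x, iter n (fdiff h) f x = 0) ->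
  polynomial_function f.
Proof.
move=> cf f0.
have [p pE] := fdiff_grid_poly 0 (oner_neq0 R) (f0 1).
exists p; suff fp : forall r : rat, f (ratr r) = p.[ratr r].
  move=> x; apply/eqP/negPn/negP => fx.
  pose g y := f y - p.[y].
  have cg : continuous g.
    by move=> y; apply: cvgB; [exact: cf | exact: continuous_horner].
  have /dense_rat : [set y | g y != 0] !=set0 by exists x; rewrite /= subr_eq0.
  case; first by apply: open_comp (@open_neq R 0) => y _; exact: cg.
  by move=> y [/= gy [r _ ry]]; move: gy; rewrite -ry /g fp subrr eqxx.
move=> r.
pose m := `|denq r|%N; pose K := `|numq r|%N.
have m0 : (m%:R : R) != 0 by rewrite pnatr_eq0 absz_eq0 denq_eq0.
have [q qE] := fdiff_grid_poly (- K%:R) (invr_neq0 m0) (f0 _).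
(* On the grid of step [1 / m] starting at [- K], the number [j] has index
   [(K + j) * m]. *)
have -> : p = q.
  apply/eqP; rewrite -subr_eq0; apply/eqP/poly_eq0_nat => j.
  rewrite hornerD hornerN.
  have := pE j; rewrite mulr1 add0r => <-.
  have := qE ((K + j) * m)%N.
  by rewrite natrM mulfK // natrD addrA addNr add0r => <-; rewrite subrr.
have k_ge0 : 0 <= numq r + (K * m)%N%:Z.
  rewrite -lerBlDr sub0r; apply: (@le_trans _ _ (- `|numq r|)).
    rewrite lerN2 -abszE PoszM ler_peMr // lez_nat absz_gt0.
    by rewrite denq_eq0.
  by rewrite lerNl -normrN ler_norm.
have -> : (ratr r : R) = - K%:R + (absz (numq r + (K * m)%N%:Z))%:R / m%:R.
  have -> : (absz (numq r + (K * m)%N%:Z))%:R = (numq r)%:~R + (K * m)%:R :> R.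
    by rewrite [LHS]pmulrn gez0_abs // rmorphD.
  rewrite mulrDl natrM mulfK //.
  by rewrite addrCA addNr addr0 /ratr (pmulrn _ m) gez0_abs.
exact: qE.
Qed.

(** * Activations without ridge relations *)

Definition ridge_independent (R : realType) (I : finType) (sigma : R -> R) :=
  forall t : I -> R, injective t ->
  forall c : I -> R,
    (forall a b, \sum_i c i * sigma (a * t i + b) = 0) -> forall i, c i = 0.

Lemma ridge_independent_continuous (R : realType) (I : finType) (sigma : R -> R) :
  continuous sigma -> ~ polynomial_function sigma -> ridge_independent I sigma.
Proof.
move=> cs ns t tI c c0 j; apply/eqP/negPn/negP => cj; apply: ns.
pose F i x := c i * sigma x.
have [p pE] : polynomial_function (F j).
  pose s := rem j (enum I).
  apply: (@continuous_fdiff_poly _ (size s)) => [x|h x].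
    by apply: cvgM; [exact: cvg_cst | exact: cs].
  apply: (@fdiff_eliminate _ _ t j s F h tI) => [|a b].
    by rewrite /s rem_filter ?enum_uniq // mem_filter /= eqxx.
  by rewrite -[RHS](c0 a b) -[RHS]big_enum [RHS](big_rem j) ?mem_enum.
by exists ((c j)^-1 *: p) => x; rewrite hornerZ -pE mulrA mulVf // mul1r.
Qed.

(** Invertibility of the Vandermonde matrix, by testing the relation on the
    Lagrange polynomial that vanishes at every [t i] except [t j]. *)
Lemma lagrange_independent (R : idomainType) (I : finType) (t c : I -> R) :
  injective t ->
  (forall k, (k < #|I|)%N -> \sum_i c i * t i ^+ k = 0) -> forall i, c i = 0.
Proof.
move=> tI c0 j; pose p := \prod_(i | i != j) ('X - (t i)%:P).
have : \sum_i c i * p.[t i] = 0.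
  under eq_bigr do rewrite horner_coef mulr_sumr.
  rewrite exchange_big /= big1 // => k _.
  under eq_bigr do rewrite mulrCA.
  rewrite -mulr_sumr c0 ?mulr0 //; apply: leq_trans (ltn_ord k) _.
  rewrite /p -big_filter size_prod_XsubC size_filter -sum1_count.
  by rewrite (sum1_card (predC1 j)) cardC1 prednK //; apply/card_gt0P; exists j.
rewrite (bigD1 j) //= big1 => [|i ij]; last first.
  by rewrite /p (bigD1 i) //= hornerM hornerXsubC subrr mul0r mulr0.
rewrite addr0 => /eqP; rewrite mulf_eq0 => /orP[/eqP //|].
rewrite horner_prod => /prodf_eq0[i ij].
by rewrite hornerXsubC subr_eq0 (inj_eq tI) eq_sym (negPf ij).
Qed.

Lemma ridge_independent_smooth (R : realType) (I : finType) (m : nat)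
    (sigma : R -> R) (a : R) :
  (#|I|.-1 <= m)%N -> continuously_differentiable m sigma ->
  (forall k, (k <= m)%N -> derive1n k sigma a <> 0) ->
  ridge_independent I sigma.
Proof.
move=> Im [ds _] sa t tI c c0; apply: (lagrange_independent tI) => k kI.
have km : (k <= m)%N by apply: leq_trans Im; rewrite -ltnS (ltn_predK kI).
(* The [k]-th derivative of the relation with respect to the slope [s]. *)
have : forall b s, \sum_i c i * t i ^+ k * derive1n k sigma (s * t i + b) = 0.
  elim: k km {kI} => [_ b s|k IHk km b s].
    by under eq_bigr do rewrite mulr1; exact: c0.
  pose T j i r := c i * t i ^+ j * derive1n j sigma (r * t i + b).
  have dT i : is_derive s 1 (T k i) (T k.+1 i s).
    have dsk : is_derive (s * t i + b) 1 (derive1n k sigma)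
        (derive1n k.+1 sigma (s * t i + b)).
      by rewrite derive1nS derive1E; apply: derivableP; exact: ds.
    have dl : is_derive s 1 (fun r => r * t i + b) (t i).
      have -> : (fun r => r * t i + b) = t i *: (@id R) + cst b.
        by apply/funext => r; rewrite -[RHS]/(t i * r + b) mulrC.
      by apply: is_derive_eq; rewrite addr0; exact: mulr1.
    have -> : T k i = (c i * t i ^+ k) *:
        (derive1n k sigma \o (fun r => r * t i + b)) by [].
    have dcomp := @is_derive1_comp _ _ (fun r => r * t i + b) _ _ _ dsk dl.
    apply: is_derive_eq.
    by rewrite /T exprSr -[LHS]/(_ * (_ * _)); ring.
  have dsum : is_derive s 1 (\sum_i T k i) (\sum_i T k.+1 i s).
    elim/big_ind2 : _ => [|F1 d1 F2 d2 D1 D2|i _]; last exact: dT.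
      exact: is_derive_cst.
    exact: is_deriveD.
  rewrite -[LHS]/(\sum_i T k.+1 i s) -(@derive_val _ _ _ _ _ _ _ dsum).
  have -> : \sum_i T k i = cst 0.
    by apply/funext => r; rewrite fct_sumE; exact: IHk (ltnW km) b r.
  exact: derive_cst.
(* At slope 0 all arguments equal [a], so [sigma^(k) a] factors out. *)
move=> /(_ a 0); under eq_bigr do rewrite mul0r add0r.
rewrite -mulr_suml => /eqP; rewrite mulf_eq0 => /orP[/eqP //|/eqP].
by move/(sa _ km).
Qed.

(** * Networks interpolating arbitrary data *)

Lemma relu_continuous (R : realType) : continuous (@relu R).
Proof. by move=> x; apply: continuous_max; [exact: cvg_cst | exact: cvg_id]. Qed.

(** A polynomial vanishing on the negative integers is zero. *)
Lemma relu_not_polynomial (R : realType) : ~ polynomial_function (@relu R).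
Proof.
case=> p pE.
have p0 : p \Po (- 'X) = 0.
  apply: poly_eq0_nat => k; rewrite horner_comp hornerN hornerX -pE.
  by apply/max_idPl; rewrite oppr_le0.
have := pE 1.
have -> : p = 0.
  apply/eqP; rewrite -(comp_poly_eq0 p (q := - 'X)) ?p0 //.
  by rewrite size_polyN size_polyX.
by rewrite horner0 /relu max_r ?ler01 // => /eqP; rewrite oner_eq0.
Qed.

(** One more hidden layer on top of any [phi] that keeps the points distinct.  Its
    units are the members of a dual family, so the output weights can be read off
    the data: the combination of units dual to [x z] is weighted by [y z]. *)
Lemma shallow_interpolation (R : realType) (sigma : R -> R) (I : finType)
    (d c i m : nat) (phi : 'cV[R]_d -> 'cV[R]_m) (x : I -> 'cV[R]_d)
    (y : I -> 'cV[R]_c) :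
  ridge_independent I sigma -> hidden_layers sigma i phi ->
  injective (phi \o x) ->
  exists2 f, neural_networks sigma i.+2 d c f & forall z, f (x z) = y z.
Proof.
move=> indep hphi /separating_direction[w wI].
pose g (p : R * R) z := sigma (p.1 * (w *m phi (x z)) 0 0 + p.2).
have [|n [p [e eE]]] := @dual_family R _ I g (0, 0).
  by move=> b b0; apply: (indep _ wI) => r s; exact: b0 (r, s).
pose W := \matrix_(j < n.+1, l < m) ((p j).1 * w 0 l).
pose b := \col_j (p j).2.
pose V := \matrix_(r < c, j < n.+1) \sum_z y z r 0 * e z j.
exists (fun v => V *m map_mx sigma (W *m phi v + b) + 0).
  exists i.+1, n.+1, (fun v => map_mx sigma (W *m phi v + b)), V, 0; split => //.
  exact: HiddenLayer.
move=> z; rewrite addr0; apply/colP => r; rewrite mxE.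
transitivity (\sum_z' y z' r 0 * (z' == z)%:R).
  under [RHS]eq_bigr do rewrite -eE mulr_sumr.
  rewrite exchange_big /=; apply: eq_bigr => j _.
  rewrite mxE mulr_suml; apply: eq_bigr => z' _; rewrite -mulrA !mxE.
  congr (_ * (_ * sigma (_ + _))); rewrite mxE mulr_sumr.
  by apply: eq_bigr => l _; rewrite mxE mulrA.
rewrite (bigD1 z) //= big1 => [|z' z'z]; last by rewrite (negPf z'z) mulr0.
by rewrite eqxx mulr1 addr0.
Qed.

(** The bias [M] dominates all entries of [phi] at the finitely many points, so
    each layer acts there as a translation. *)
Lemma relu_injective_layers (R : realType) (I : finType) (d i : nat)
    (x : I -> 'cV[R]_d) :
  (0 < d)%N -> injective x ->
  exists2 phi : 'cV[R]_d -> 'cV[R]_d,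
    hidden_layers (@relu R) i phi & injective (phi \o x).
Proof.
move=> d0 xI; elim: i => [|i [phi hphi phiI]].
  by exists id; [exact: HiddenInput | ].
pose M := \sum_z \sum_j `|phi (x z) j 0|.
have pos z j : 0 <= phi (x z) j 0 + M.
  rewrite addrC -lerBlDr sub0r; apply: (le_trans (ler_norm _)); rewrite normrN.
  rewrite /M (bigD1 z) //= (bigD1 j) //= -addrA lerDl.
  by rewrite addr_ge0 ?sumr_ge0 // => z' _; exact: sumr_ge0.
exists (fun v => map_mx (@relu R) (1%:M *m phi v + const_mx M)).
  exact: HiddenLayer.
move=> z z' /= /colP zz'; apply: phiI; apply/colP => j.
have := zz' j; rewrite !mul1mx !mxE /relu !max_r ?pos //; exact: addIr.
Qed.

Lemma network_interpolation (R : realType) (sigma : R -> R) (L d c : nat)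
    (I : finType) (x : I -> 'cV[R]_d) (y : I -> 'cV[R]_c) :
  (0 < d)%N ->
  [\/ sigma = @relu R /\ (2 <= L)%N,
      [/\ continuous sigma, ~ polynomial_function sigma & L = 2%N] |
      [/\ continuously_differentiable (#|I| * d - d) sigma,
          exists a : R, forall k : nat, (k <= #|I| * d - d)%N ->
            derive1n k sigma a <> 0 &
          L = 2%N]] ->
  injective x ->
  exists2 f, neural_networks sigma L d c f & forall z, f (x z) = y z.
Proof.
move=> d0 + xI; case.
- move=> [-> ]; case: L => [|[|i]] // _.
  have [phi hphi phiI] := relu_injective_layers i d0 xI.
  apply: (shallow_interpolation y _ hphi phiI).
  exact: ridge_independent_continuous (@relu_continuous R) (@relu_not_polynomial R).
- move=> [cs ns ->]; apply: (shallow_interpolation y _ (HiddenInput sigma d) xI).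
  exact: ridge_independent_continuous.
- move=> [ds [a sa] ->]; apply: (shallow_interpolation y _ (HiddenInput sigma d) xI).
  apply: (ridge_independent_smooth (a := a) _ ds sa).
  (* With [n] points, [n - 1 <= (n - 1) * d] because [d] is positive. *)
  by rewrite -{2}[d]mul1n -mulnBl subn1 leq_pmulr.
Qed.

Theorem proposition4p2 (R : realType) (d c cF cB : nat)
  (d_gt0 : (0 < d)%N) (c_gt0 : (0 < c)%N)
  (cF_gt0 : (0 < cF)%N) (cB_gt0 : (0 < cB)%N)
  (Omega Gamma : set 'cV[R]_d)
  (Omega_domain : bounded_lipschitz_domain Omega)
  (Gamma_boundary : Gamma `<=` boundary Omega)
  (Oh Gh Dh : {fset 'cV[R]_d})
  (Oh_Omega : [set` Oh] `<=` Omega)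
  (Gh_Gamma : [set` Gh] `<=` Gamma)
  (Oh_Gh_disjoint : (Oh `&` Gh)%fset = fset0)
  (Dh_sub : (Dh `<=` Oh `|` Gh)%fset)
  (Fh : grid_function c Oh Gh -> Oh -> 'cV[R]_cF)
  (Bh : grid_function c Oh Gh -> Gh -> 'cV[R]_cB)
  (ustar : Dh -> 'cV[R]_c)
  (alphaF alphaB alphaD : R)
  (alphaF_ge0 : 0 <= alphaF) (alphaB_ge0 : 0 <= alphaB)
  (alphaD_ge0 : 0 <= alphaD)
  (omegaF : Oh -> R) (omegaB : Gh -> R) (omegaD : Dh -> R)
  (nu : R) (nu_ge1 : 1 <= nu)
  (sigma : R -> R) (L : nat) :
  let N := #|` (Oh `|` Gh)%fset| in
  let l := (N * d)%N in
  let JFD := J_FD Fh Bh Dh_sub ustar alphaF alphaB alphaD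
               omegaF omegaB omegaD nu in
  let Jtheta := fun f : 'cV[R]_d -> 'cV[R]_c => JFD (grid_values Oh Gh f) in
  let H : set ('cV[R]_d -> 'cV[R]_c) := neural_networks sigma L d c in
  [\/ sigma = @relu R /\ (2 <= L)%N,
      [/\ continuous sigma, ~ polynomial_function sigma & L = 2%N] |
      [/\ continuously_differentiable (l - d) sigma,
          exists a : R, forall k : nat, (k <= l - d)%N ->
            derive1n k sigma a <> 0 &
          L = 2%N]] ->
  (forall uh : grid_function c Oh Gh,
     is_minimizer setT JFD uh ->
     exists utheta : 'cV[R]_d -> 'cV[R]_c,
       [/\ is_minimizer H Jtheta utheta, JFD uh = Jtheta utheta &
           forall z : (Oh `|` Gh)%fset, uh z = utheta (val z)]) /\
  (forall utheta : 'cV[R]_d -> 'cV[R]_c,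
     is_minimizer H Jtheta utheta ->
     exists uh : grid_function c Oh Gh,
       [/\ is_minimizer setT JFD uh, JFD uh = Jtheta utheta &
           forall z : (Oh `|` Gh)%fset, uh z = utheta (val z)]).
Proof.
move=> N l JFD Jtheta H hyp.
have interp (u : grid_function c Oh Gh) : exists2 f, H f & grid_values Oh Gh f = u.
  have [|f Hf fu] := @network_interpolation R sigma L d c
      (fset_sub_type (Oh `|` Gh)%fset) val u d_gt0 _ val_inj.
    by rewrite -cardfE.
  by exists f => //; apply/ffunP => z; rewrite ffunE.
split=> [uh [_ uh_min]|utheta [_ utheta_min]].
- have [f Hf fu] := interp uh.
  have JE : Jtheta f = JFD uh := congr1 JFD fu.
  exists f; split; [split | exact: esym | by move=> z; rewrite -fu ffunE].
    exact: Hf.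
  by move=> f' _; rewrite JE; exact: uh_min.
- exists (grid_values Oh Gh utheta); split; [split | by [] | by move=> z; rewrite ffunE].
    exact: I.
  move=> u _; have [f Hf <-] := interp u; exact: utheta_min.
Qed.
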